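(* Let $p>3$ be a prime, and let $t$ be a variable. Then $$P_{[p/6]}(t)\equiv -\left(\frac{3}{p}\right)\sum_{x=0}^{p-1}(x^3-3x+2t)^{\frac{p-1}{2}}\pmod p .$$
   Context: $R_p$ is the ring of rational numbers whose denominator is coprime to $p$. The congruence is one of polynomials in $R_p[t]$ (coefficientwise congruence modulo $p$). $\left(\frac{3}{p}\right)$ is the Legendre symbol. $[x]$ is the greatest integer not exceeding $x$. $P_n(x)$ is the $n$-th Legendre polynomial: $P_0(x)=1$, $P_1(x)=x$, $(n+1)P_{n+1}(x)=(2n+1)xP_n(x)-nP_{n-1}(x)$ for $n\ge 1$. *)

(* Defs.v *)
From mathcomp Require Import all_boot all_order all_algebra.
Set Implicit Arguments.
Unset Strict Implicit.
Unset Printing Implicit Defensive.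
Import Order.TTheory GRing.Theory Num.Theory.
Local Open Scope ring_scope.

Definition Rp (p : nat) : {pred rat} := [pred q | coprime `|denq q| p].

Definition eqpoly_mod (p : nat) (f g : {poly rat}) : Prop :=
  [/\ f \is a polyOver (Rp p), g \is a polyOver (Rp p)
    & exists2 h, h \is a polyOver (Rp p) & f - g = p%:R *: h].

(* For a prime p > 2; a square class mod p is tested on 0, ..., p - 1. *)
Definition legendre_symbol (a : int) (p : nat) : int :=
  if (p %| a)%Z then 0
  else if [exists x : 'I_p, ((x : nat)%:Z ^+ 2 == a %[mod p])%Z] then 1
  else -1.

Fixpoint legendre_poly (n : nat) : {poly rat} :=
  match n with
  | 0 => 1
  | n1.+1 =>
    match n1 with
    | 0 => 'X
    | m.+1 =>
      n1.+1%:R^-1 *: ((2 * n1 + 1)%:R *: ('X * legendre_poly n1)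
                      - n1%:R *: legendre_poly m)
    end
  end.

Lemma legendre_poly_rec (n : nat) : (1 <= n)%N ->
  n.+1%:R *: legendre_poly n.+1 =
    (2 * n + 1)%:R *: ('X * legendre_poly n) - n%:R *: legendre_poly n.-1.
Proof. by case: n => // m _; rewrite /= scalerA divff ?scale1r ?pnatr_eq0. Qed.

(* Main.v *)
From HB Require Import structures.
Require Import Defs.
From mathcomp Require Import all_boot all_order all_algebra.
From mathcomp Require Import all_solvable all_field.
From mathcomp Require Import ring zify.
Import GRing.Theory.
Local Open Scope ring_scope.

(** The point t = 1 makes both sides explicit.  Write u = t - 1, n = [p/6] and
    m = (p - 1)/2.

    The Legendre polynomial has the classical expansion
    P_n(1 + u) = sum_k C(n, k) C(n + k, k) (u/2)^k  (coef_legendre_shift).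

    On the other side, x^3 - 3x + 2t = (x - 1)^2 (x + 2) + 2u, so the
    coefficient of u^k in the sum over x is 2^k C(m, k) times the power sum
    sum_x ((x - 1)^2 (x + 2))^(m - k).  With y = x - 1 this is
    sum_y y^(2m - 2k) (y + 3)^(m - k).  A power y^i with i < 2 (p - 1) sums to
    zero over F_p unless i = p - 1, where it sums to -1 (sum_finField_exp);
    hence only the coefficient of y^(p - 1) survives, and the power sum is
    - C(m - k, 2k) 3^(m - 3k)  (sum_cubic_exp).  Since (3/p) = 3^m in F_p
    (legendre_symbol_expE), the factor - (3/p) cancels the sign and turns
    3^(m - 3k) into 27^(-k).

    The theorem is therefore the congruence
    27^k C(n, k) C(n + k, k) = 4^k C(m, k) C(m - k, 2k)  in F_p
    (trinomial_legendre).  Both sequences in k satisfy first-order recurrences,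
    and these agree modulo p because 2m = -1 and 36 n (n + 1) = -5 in F_p: the
    ratios of consecutive terms are both proportional to
    (6k + 1) (6k + 5) / (k + 1)^2.  For k > n both sides vanish.

    Congruences between coefficients are divisibilities between integers once
    the powers of 2 are cleared, and the substitution t = 1 + u is invertible
    over R_p, so they give the congruence of polynomials over R_p. *)

(** * Congruences over the local ring R_p *)

(** Membership in R_p can be read off any fraction with denominator prime to
    p, reduced or not: the reduced denominator divides it. *)
Lemma Rp_frac (p : nat) (a b : int) (q : rat) :
  coprime `|b| p -> q * b%:~R = a%:~R -> q \in Rp p.
Proof.
move=> bp qb; rewrite inE; apply: coprime_dvdl bp.
have ab : numq q * b = a * denq q.
  apply: (@intr_inj rat); rewrite !rmorphM /= -qb mulrAC; congr (_ * _).
  by rewrite numqE.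
have : (denq q %| numq q * b)%Z by rewrite ab dvdz_mull.
by rewrite Gauss_dvdzr // coprimez_sym; apply: coprime_num_den.
Qed.

Lemma Rp_int (p : nat) (z : int) : z%:~R \in Rp p.
Proof. by apply: (@Rp_frac p z 1); rewrite ?mulr1 ?coprime1n. Qed.

Lemma Rp_subring (p : nat) : subring_closed (Rp p).
Proof.
have den2 (x y : rat) : x \in Rp p -> y \in Rp p ->
    coprime `|denq x * denq y| p.
  by rewrite !inE abszM coprimeMl => -> ->.
split=> [|x y xp yp|x y xp yp]; first exact: (@Rp_int p 1).
- apply: (@Rp_frac p (numq x * denq y - numq y * denq x) _ _ (den2 _ _ xp yp)).
  by rewrite !(rmorphB, rmorphM) /= !numqE; ring.
- apply: (@Rp_frac p (numq x * numq y) _ _ (den2 _ _ xp yp)).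
  by rewrite !rmorphM /= !numqE; ring.
Qed.

HB.instance Definition _ (p : nat) :=
  GRing.isSubringClosed.Build rat (Rp p) (Rp_subring p).

Lemma eqpoly_mod_coef (p : nat) (f g : {poly rat}) : (0 < p)%N ->
  (forall k, g`_k \in Rp p) -> (forall k, (f`_k - g`_k) / p%:R \in Rp p) ->
  eqpoly_mod p f g.
Proof.
move=> p_gt0 gp fgp; set h := p%:R^-1 *: (f - g).
have p_neq0 : p%:R != 0 :> rat by rewrite Num.Theory.pnatr_eq0 -lt0n.
have fgE : f - g = p%:R *: h by rewrite scalerA divff ?scale1r.
have hp : h \is a polyOver (Rp p).
  by apply/polyOverP => k; rewrite coefZ coefB mulrC.
have gp' : g \is a polyOver (Rp p) by apply/polyOverP.
split=> //; last by exists h.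
rewrite -(subrK g f) fgE rpredD // polyOverZ //; exact: (Rp_int p p).
Qed.

Lemma eqpoly_mod_comp (p : nat) (f g u : {poly rat}) :
  u \is a polyOver (Rp p) -> eqpoly_mod p f g ->
  eqpoly_mod p (f \Po u) (g \Po u).
Proof.
move=> up [fp gp [h hp fgE]]; split; try exact: polyOver_comp.
exists (h \Po u); first exact: polyOver_comp.
by rewrite -comp_polyB fgE comp_polyZ.
Qed.

(** Congruence can be tested after expanding at t = 1, because 'X - 1 also has
    coefficients in R_p. *)
Lemma eqpoly_mod_shift (p : nat) (f g : {poly rat}) :
  eqpoly_mod p (f \Po ('X + 1)) (g \Po ('X + 1)) -> eqpoly_mod p f g.
Proof.
have shiftK (h : {poly rat}) : (h \Po ('X + 1)) \Po ('X - 1) = h.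
  by rewrite -comp_polyA comp_polyD comp_polyX comp_polyC subrK comp_polyXr.
have Xp : 'X - 1 \is a polyOver (Rp p).
  by rewrite rpredB ?polyOverX ?rpred1.
by move/(eqpoly_mod_comp _ _ _ _ Xp); rewrite !shiftK.
Qed.

(** * The expansion of the Legendre polynomials at 1 *)

Definition legendre_coef (n k : nat) : nat := 'C(n, k) * 'C(n + k, k).

Lemma legendre_coef_gt (n k : nat) : (n < k)%N -> legendre_coef n k = 0%N.
Proof. by move=> nk; rewrite /legendre_coef bin_small. Qed.

(** Subtracting in the ring rather than in nat costs nothing: when n < k both
    sides vanish with the binomials. *)
Lemma legendre_coefSr (R : comNzRingType) (n k : nat) :
  k.+1%:R ^+ 2 * (legendre_coef n k.+1)%:R =
  (n%:R - k%:R) * (n + k).+1%:R * (legendre_coef n k)%:R :> R.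
Proof.
case: (ltnP n k) => [nk | kn].
  by rewrite (legendre_coef_gt n k) // (legendre_coef_gt n k.+1) ?mulr0 // leqW.
rewrite -natrB // -natrX -!natrM; congr _%:R.
have h1 := mul_bin_left n k; have h2 := mul_bin_diag (n + k.+1) k.
rewrite /legendre_coef addnS /= in h1 h2 *.
rewrite (_ : _ * _ = (k.+1 * 'C(n, k.+1)) * (k.+1 * 'C((n + k).+1, k.+1)))%N.
  by rewrite h1 -h2; ring.
by ring.
Qed.

Lemma legendre_coefSl (R : comNzRingType) (n k : nat) :
  (n.+1%:R - k%:R) * (legendre_coef n.+1 k)%:R =
  (n + k).+1%:R * (legendre_coef n k)%:R :> R.
Proof.
case: (ltnP n k) => [nk | kn].
  rewrite [legendre_coef n k]legendre_coef_gt // mulr0.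
  move: nk; rewrite leq_eqVlt => /orP[/eqP-> | nk].
    by rewrite subrr mul0r.
  by rewrite legendre_coef_gt // mulr0.
rewrite -natrB 1?ltnW // -!natrM; congr _%:R.
have h1 := mul_bin_down n.+1 k; have h2 := mul_bin_down (n.+1 + k) k.
rewrite addnK addSn /= in h2; rewrite /= in h1.
rewrite /legendre_coef addSn mulnA -h1.
rewrite (mulnC n.+1) -mulnA -h2; ring.
Qed.

(** Up to powers of 2 this is the coefficient of u ^ (k + 1) in the three-term
    recurrence of the P_n.  After multiplication by (k + 1) ^ 2, the two
    first-order recurrences express every term through legendre_coef n.+1 k. *)
Lemma legendre_coef_rec (n k : nat) :
  n.+2%:R * (legendre_coef n.+2 k.+1)%:R + n.+1%:R * (legendre_coef n k.+1)%:R =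
  (2 * n + 3)%:R *
    ((legendre_coef n.+1 k.+1)%:R + 2 * (legendre_coef n.+1 k)%:R) :> rat.
Proof.
have k2 : k.+1%:R ^+ 2 != 0 :> rat by rewrite expf_neq0 // Num.Theory.pnatr_eq0.
apply: (mulfI k2).
have e1 := legendre_coefSr rat n k.
have e2 := legendre_coefSr rat n.+1 k.
have e3 := legendre_coefSr rat n.+2 k.
have e4 := legendre_coefSl rat n k.
have e5 := legendre_coefSl rat n.+1 k.
set a := (legendre_coef n k)%:R in e1 e4 *.
set b := (legendre_coef n.+1 k)%:R in e2 e4 e5 *.
set c := (legendre_coef n.+2 k)%:R in e3 e5 *.
rewrite [RHS](_ : _ = (2 * n + 3)%:R *
  (k.+1%:R ^+ 2 * (legendre_coef n.+1 k.+1)%:R + 2 * k.+1%:R ^+ 2 * b));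
  last by ring.
rewrite mulrDr !(mulrCA (_ ^+ 2)) e1 e2 e3.
transitivity (n.+2%:R * (n.+2 + k).+1%:R * ((n.+2%:R - k%:R) * c)
    + n.+1%:R * (n%:R - k%:R) * ((n + k).+1%:R * a)); first by ring.
by rewrite e5 -e4; ring.
Qed.

Lemma coef_legendre_shift (n k : nat) :
  (legendre_poly n \Po ('X + 1))`_k = (legendre_coef n k)%:R / 2 ^+ k.
Proof.
elim/ltn_ind: n k => -[|[|n]] IH k.
- rewrite /= comp_polyC coefC; case: k => [|k]; first by rewrite /= divr1.
  by rewrite /= legendre_coef_gt ?mul0r.
- rewrite /= comp_polyX coefD coefX coefC.
  case: k => [|[|k]]; rewrite ?divr1 //.
  by rewrite legendre_coef_gt ?mul0r.
have n2 : n.+2%:R != 0 :> rat by rewrite Num.Theory.pnatr_eq0.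
apply: (mulfI n2).
rewrite -coefZ -comp_polyZ legendre_poly_rec // comp_polyB !comp_polyZ.
rewrite comp_polyM comp_polyX mulrDl mul1r coefB !coefZ coefD coefXM !IH //.
case: k => [|k].
  by rewrite /= /legendre_coef !bin0 !expr0 add0r; ring.
have rec := legendre_coef_rec n k.
move/(canRL (addrK _)): rec => rec.
rewrite /= [RHS]mulrA rec exprS; field.
by rewrite expf_neq0.
Qed.

Lemma coef_linear_exp (R : comNzRingType) (a b : R) (m k : nat) :
  ((a%:P + b *: 'X) ^+ m)`_k = a ^+ (m - k) * b ^+ k *+ 'C(m, k).
Proof.
rewrite exprDn coef_sum.
under eq_bigr => i _ do
  rewrite coefMn exprZn -scalerAr coefZ -rmorphXn coefCM coefXn.
case: (ltnP m k) => [mk | km].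
  rewrite bin_small // big1 // => i _.
  by rewrite gtn_eqF ?mulr0 ?mul0rn // (leq_trans (ltn_ord i)).
rewrite (bigD1 (inord k)) //= big1 => [|i /eqP ik].
  by rewrite inordK // eqxx mulr1 addr0 mulrC.
case: eqP => [ki|_]; last by rewrite !mulr0 mul0rn.
by case: ik; apply: val_inj; rewrite /= inordK.
Qed.

(** * Power sums and quadratic residues in finite fields *)

Lemma finField_expf1 (F : finFieldType) (x : F) : x != 0 -> x ^+ #|F|.-1 = 1.
Proof.
move=> x0; apply: (mulfI x0).
by rewrite -exprS prednK ?expf_card ?mulr1 // ltnW ?finNzRing_gt1.
Qed.

Lemma finField_prim_root (F : finFieldType) :
  {z : F | #|F|.-1.-primitive_root z}.
Proof.
apply/sigW.
have F1 := finNzRing_gt1 F.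
have /hasP[z _ zP] : has #|F|.-1.-primitive_root (enum (predC1 (0 : F))).
  apply: has_prim_root; rewrite ?enum_uniq -?cardE ?cardC1 //.
    by rewrite -subn1 subn_gt0.
  apply/allP => x; rewrite mem_enum => x0.
  by rewrite unity_rootE finField_expf1.
by exists z.
Qed.

(** If z is a primitive root and z ^ i != 1, the substitution y -> z y
    multiplies the sum by z ^ i without changing it, so the sum is 0.  For
    i = 0 the convention 0 ^ 0 = 1 makes the sum #|F|, which is also 0. *)
Lemma sum_finField_exp (F : finFieldType) (i : nat) :
  (i < 2 * #|F|.-1)%N ->
  \sum_(y : F) y ^+ i = - (i == #|F|.-1)%:R.
Proof.
have F1 := finNzRing_gt1 F.
have card0 : #|F|%:R = 0 :> F.
  (* Translation by 1 permutes F and adds #|F| to the sum of its elements. *)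
  apply: (addrI (\sum_(y : F) y)).
  rewrite addr0 [RHS](reindex_inj (addIr 1)) big_split /=.
  by rewrite sumr_const.
case: (posnP i) => [-> _ | i_gt0 i_lt].
  rewrite sumr_const card0 eq_sym -leqn0 leqNgt -subn1 subn_gt0 F1.
  by rewrite oppr0.
have [->|iF] := eqVneq i #|F|.-1.
  rewrite (bigD1 0) //= expr0n eqn0Ngt -subn1 subn_gt0 F1 add0r.
  under eq_bigr => x x0 do rewrite subn1 finField_expf1 //.
  rewrite sumr_const (@eq_card _ _ (predC1 (0:F))) // cardC1.
  by rewrite -subn1 natrB 1?ltnW // card0 sub0r.
have [z zP] := finField_prim_root F.
have zi1 : z ^+ i != 1.
  rewrite -(prim_order_dvd zP); apply/negP => /dvdnP[[|[|c]] ic].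
  - by rewrite ic in i_gt0.
  - by rewrite ic mul1n eqxx in iF.
  - by rewrite ic ltn_mul2r ltnNge /= andbF in i_lt.
have z0 : z != 0.
  apply/eqP => z0; move/eqP: (prim_expr_order zP).
  by rewrite z0 expr0n eqn0Ngt -subn1 subn_gt0 F1 eq_sym oner_eq0.
apply/eqP; rewrite oppr0; set S := (X in X == 0).
have : (z ^+ i - 1) * S == 0.
  rewrite mulrBl mul1r subr_eq0 mulr_sumr /S; apply/eqP.
  rewrite [RHS](reindex_inj (mulfI z0)); apply: eq_bigr => y _.
  by rewrite exprMn.
by rewrite mulf_eq0 subr_eq0 (negPf zi1).
Qed.

(** Expanding (y + a) ^ j gives powers of y with exponents between 2j and
    3j < 2 (#|F| - 1), so at most one of them, #|F| - 1, has a nonzero sum. *)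
Lemma sum_finField_binomial (F : finFieldType) (a : F) (j : nat) :
  (2 * j <= #|F|.-1)%N ->
  \sum_(y : F) y ^+ (2 * j) * (y + a) ^+ j =
  - (a ^+ (j - (#|F|.-1 - 2 * j)) *+ 'C(j, #|F|.-1 - 2 * j)).
Proof.
have F1 := finNzRing_gt1 F.
move=> jF; set N := #|F|.-1 in jF *.
have N0 : (0 < N)%N by rewrite /N -subn1 subn_gt0.
under eq_bigr => y _.
  rewrite addrC exprDn mulr_sumr.
  under eq_bigr => l _ do rewrite mulrnAr mulrCA -exprD.
over.
rewrite exchange_big /=.
under eq_bigr => l _.
  rewrite sumrMnl -mulr_sumr sum_finField_exp; last by have := ltn_ord l; lia.
over.
case: (ltnP j (N - 2 * j)) => [lt | le].
  rewrite bin_small // mulr0n oppr0 big1 // => l _.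
  have /negPf-> : (2 * j + l)%N != #|F|.-1 by have := ltn_ord l; lia.
  by rewrite oppr0 mulr0 mul0rn.
rewrite (bigD1 (inord (N - 2 * j))) //= big1 => [|l /eqP lN]; last first.
  case: eqP => [lE|_]; last by rewrite oppr0 mulr0 mul0rn.
  by case: lN; apply: val_inj; rewrite /= inordK ?ltnS // /N -lE addKn.
by rewrite inordK ?ltnS // subnKC // eqxx mulrN1 addr0 mulNrn.
Qed.

Lemma intr_Fp_eq0 (p : nat) (z : int) : prime p ->
  (z%:~R == 0 :> 'F_p) = (p %| z)%Z.
Proof.
move=> p_pr; rewrite dvdzE absz_nat (dvdn_pcharf (pchar_Fp p_pr)).
by case: z => z //; rewrite NegzE rmorphN oppr_eq0.
Qed.

Lemma odd_prime_half (p : nat) :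
  prime p -> (2 < p)%N -> p = (2 * ((p - 1) %/ 2)).+1.
Proof.
move=> p_pr p_gt2; case: (even_prime p_pr) => [p2|]; last by lia.
by rewrite p2 in p_gt2.
Qed.

(** Euler's criterion.  If a = z ^ i with z a primitive root and m = (p - 1)/2,
    then a ^ m = 1 means that 2m divides i m, that is, that i is even. *)
Lemma legendre_symbol_expE (a : int) (p : nat) : prime p -> (2 < p)%N ->
  (legendre_symbol a p)%:~R = a%:~R ^+ ((p - 1) %/ 2) :> 'F_p.
Proof.
move=> p_pr p_gt2; set m := ((p - 1) %/ 2)%N.
have m2 : (2 * m = p.-1)%N.
  by have := odd_prime_half p p_pr p_gt2; rewrite -/m; lia.
rewrite /legendre_symbol -intr_Fp_eq0 //.
have m0 : (m == 0%N) = false by lia.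
case: eqP => [->|/eqP a0]; first by rewrite expr0n m0.
have [z] := finField_prim_root 'F_p; rewrite card_Fp // => zP.
have fermat := finField_expf1 'F_p; rewrite card_Fp // in fermat.
have a1 := fermat _ a0.
case: existsP => [[x /eqP xa]|nsq].
  have {}xa : a%:~R = x%:R ^+ 2 :> 'F_p.
    apply/esym/eqP; rewrite -subr_eq0 -[x%:R]/((x : nat)%:Z%:~R).
    by rewrite -rmorphXn -rmorphB /= intr_Fp_eq0 // -eqz_mod_dvd xa.
  rewrite xa -exprM m2 fermat //.
  by apply: contraNneq a0 => x0; rewrite xa x0 expr0n.
have /eqP : (a%:~R ^+ m) ^+ 2 = 1 :> 'F_p by rewrite -exprM mulnC m2.
rewrite sqrf_eq1 => /orP[/eqP am | /eqP->]; last by rewrite rmorphN.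
case: nsq; have [i ai] := prim_rootP zP a1.
have : (2 * m %| i * m)%N by rewrite m2 (prim_order_dvd zP) exprM -ai am.
rewrite dvdn_pmul2r; last by lia.
case/dvdnP => c ic; rewrite ic in ai.
have lt_p (y : 'F_p) : (y < p)%N by rewrite -{2}(Fp_cast p_pr).
exists (Ordinal (lt_p (z ^+ c))); rewrite eqz_mod_dvd -intr_Fp_eq0 //=.
by rewrite rmorphB rmorphXn /= subr_eq0 -[_%:~R]/(_%:R) natr_Zp ai exprM.
Qed.

Lemma big_Fp_nat (p : nat) (V : zmodType) (G : 'F_p -> V) : prime p ->
  \sum_(0 <= x < p) G x%:R = \sum_(y : 'F_p) G y.
Proof.
move=> p_pr; rewrite -{1}(Fp_cast p_pr) big_mkord.
by apply: eq_bigr => y _; rewrite natr_Zp.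
Qed.

(** * The congruence between the coefficients *)

(** This is the multinomial coefficient m! / (k! (2k)! (m - 3k)!),
    or 0 when m < 3k. *)
Definition trinomial (m k : nat) : nat := 'C(m, k) * 'C(m - k, 2 * k).

Lemma ffactnD (n a b : nat) : n ^_ (a + b) = (n ^_ a * (n - a) ^_ b)%N.
Proof.
elim: b => [|b IHb]; first by rewrite addn0 ffactn0 muln1.
by rewrite addnS !ffactnSr IHb mulnA subnDA.
Qed.

Lemma trinomial_fact (m k : nat) :
  (trinomial m k * (k`! * (2 * k)`!) = m ^_ (3 * k))%N.
Proof.
rewrite (_ : 3 * k = k + 2 * k)%N; last by ring.
by rewrite ffactnD -!bin_ffact /trinomial; ring.
Qed.

(** All subtractions are truncated; the statement survives this because both
    sides vanish as soon as m < 3k + 3. *)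
Lemma trinomialS (m k : nat) :
  (2 * k.+1 ^ 2 * (2 * k).+1 * trinomial m k.+1 =
   (m - 3 * k) * (m - 3 * k - 1) * (m - 3 * k - 2) * trinomial m k)%N.
Proof.
have f0 : (0 < k`! * (2 * k)`!)%N by rewrite muln_gt0 !fact_gt0.
apply/eqP; rewrite -(eqn_pmul2r f0); apply/eqP.
rewrite -[RHS]mulnA trinomial_fact.
have := trinomial_fact m k.+1.
rewrite [(3 * _)%N]mulnS [(2 * k.+1)%N]mulnS !(addSn, add0n).
rewrite !ffactnSr !factS !subnS !subn0 => e.
rewrite [LHS](_ : _ =
  m ^_ (3 * k) * (m - 3 * k) * (m - 3 * k).-1 * (m - 3 * k).-2)%N.
  by ring.
by rewrite -e; ring.
Qed.

(** Induction on k, with both first-order recurrences read modulo p.  The factor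
    (k + 1) ^ 2 (2k + 1) is invertible because 2k + 1 < p. *)
Lemma trinomial_legendre (p k : nat) : prime p -> (3 < p)%N ->
  (k <= p %/ 6)%N ->
  27 ^+ k * (legendre_coef (p %/ 6) k)%:R =
  4 ^+ k * (trinomial ((p - 1) %/ 2) k)%:R :> 'F_p.
Proof.
move=> p_pr p_gt3.
set n := (p %/ 6)%N; set m := ((p - 1) %/ 2)%N.
have p_odd := odd_prime_half p p_pr (ltnW p_gt3); rewrite -/m in p_odd.
have p_mod : p = (6 * n + 1)%N \/ p = (6 * n + 5)%N.
  have : ~~ (3 %| p)%N by rewrite dvdn_prime2 // neq_ltn p_gt3.
  rewrite /n; lia.
have p0 (i : nat) : p = i -> i%:R = 0 :> 'F_p.
  by move=> <-; rewrite (pcharf0 (pchar_Fp p_pr)).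
have small_neq0 (i : nat) : (0 < i < p)%N -> i%:R != 0 :> 'F_p.
  by move=> ip; rewrite -(dvdn_pcharf (pchar_Fp p_pr)) gtnNdvd; lia.
have mE : 2 * m%:R = -1 :> 'F_p.
  by apply/eqP; rewrite -addr_eq0 -natrM natr1 p0.
(* p = 6n + 1 or p = 6n + 5, so (6n + 1) (6n + 5) vanishes in F_p. *)
have nE : 36 * (n%:R ^+ 2 + n%:R) = - 5 :> 'F_p.
  have : (6 * n%:R + 1) * (6 * n%:R + 5) = 0 :> 'F_p.
    apply/eqP; rewrite mulf_eq0.
    by case: p_mod => /p0; rewrite natrD natrM => ->; rewrite eqxx ?orbT.
  by move=> e; apply/eqP; rewrite -subr_eq0 -e; apply/eqP; ring.
elim: k => [|k IHk] kn.
  by rewrite /legendre_coef /trinomial !bin0 !expr0.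
have k2 : 2 * k.+1%:R ^+ 2 * (2 * k).+1%:R * 2 != 0 :> 'F_p.
  by rewrite !mulf_neq0 ?expf_neq0 ?small_neq0 //; lia.
apply: (mulfI k2).
set L := fun i => (legendre_coef n i)%:R : 'F_p.
set T := fun i => (trinomial m i)%:R : 'F_p.
have d : k.+1%:R ^+ 2 * L k.+1 = (n%:R - k%:R) * (n + k).+1%:R * L k.
  exact: legendre_coefSr.
have e : 2 * k.+1%:R ^+ 2 * (2 * k).+1%:R * T k.+1 =
  (m%:R - 3 * k%:R) * (m%:R - 3 * k%:R - 1) * (m%:R - 3 * k%:R - 2) * T k.
  have := congr1 (fun i => i%:R : 'F_p) (trinomialS m k); rewrite /T.
  (* Here m - 3k >= 3 since 3(k + 1) <= 3n <= m, so no subtraction truncates. *)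
  rewrite !natrM !natrB; try lia.
  by rewrite natrM => <-; rewrite expr2; ring.
rewrite -/(L k.+1) -/(T k.+1).
transitivity
  (4 * (2 * k%:R + 1) * 27 * 27 ^+ k * (k.+1%:R ^+ 2 * L k.+1) : 'F_p).
  by rewrite (exprS _ k); ring.
transitivity (8 * 4 ^+ k *
  (2 * k.+1%:R ^+ 2 * (2 * k).+1%:R * T k.+1) : 'F_p); last first.
  by rewrite (exprS _ k); ring.
rewrite d e.
transitivity (4 * (2 * k%:R + 1) * 27 *
  ((n%:R - k%:R) * (n + k).+1%:R) * (27 ^+ k * L k) : 'F_p); first by ring.
rewrite /L IHk 1?ltnW // -/(T k).
(* Both sides are now - 3 (2k + 1) (6k + 1) (6k + 5) times 4 ^ k T_k. *)
transitivity (3 * (2 * k%:R + 1) *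
  (36 * (n%:R ^+ 2 + n%:R) - 36 * (k%:R ^+ 2 + k%:R)) *
  (4 ^+ k * T k) : 'F_p); first by ring.
rewrite nE.
transitivity ((2 * m%:R - 6 * k%:R) * (2 * m%:R - 6 * k%:R - 2) *
  (2 * m%:R - 6 * k%:R - 4) * (4 ^+ k * T k) : 'F_p); last by ring.
by rewrite mE; ring.
Qed.

Lemma sum_cubic_exp (p k : nat) :
  prime p -> (3 < p)%N -> (k <= (p - 1) %/ 2)%N ->
  \sum_(0 <= x < p) (x%:R ^+ 3 - 3 * x%:R + 2) ^+ ((p - 1) %/ 2 - k) =
  - (3 ^+ ((p - 1) %/ 2 - k - 2 * k) *+ 'C((p - 1) %/ 2 - k, 2 * k)) :> 'F_p.
Proof.
move=> p_pr p_gt3; set m := ((p - 1) %/ 2)%N => km.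
have p_odd := odd_prime_half p p_pr (ltnW p_gt3); rewrite -/m in p_odd.
rewrite (big_Fp_nat p _ (fun x => (x ^+ 3 - 3 * x + 2) ^+ (m - k))) //.
rewrite (reindex_inj (addIr 1)) /=.
under eq_bigr => y _.
  (* With x = y + 1, this is (x - 1) ^ 2 (x + 2) = y ^ 2 (y + 3). *)
  rewrite (_ : _ + 2 = y ^+ 2 * (y + 3)); last by ring.
  rewrite exprMn -exprM.
over.
rewrite sum_finField_binomial card_Fp //; last by lia.
by rewrite (_ : p.-1 - 2 * (m - k) = 2 * k)%N //; lia.
Qed.

(** The coefficients of u ^ k on the two sides, both multiplied by 2 ^ k, agree
    in F_p.  The identity 3 ^ m (3 ^ (3k) 3 ^ (m - 3k)) = 3 ^ (p - 1) = 1
    combines the Legendre symbol with the powers of 3 from the power sum. *)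
Lemma legendre_coef_Fp (p k : nat) : prime p -> (3 < p)%N ->
  (legendre_coef (p %/ 6) k)%:R =
  - ((legendre_symbol 3 p)%:~R * \sum_(0 <= x < p)
      (x%:R ^+ 3 - 3 * x%:R + 2) ^+ ((p - 1) %/ 2 - k) *
      (4 ^+ k * ('C((p - 1) %/ 2, k))%:R)) :> 'F_p.
Proof.
move=> p_pr p_gt3.
set n := (p %/ 6)%N; set m := ((p - 1) %/ 2)%N.
have p_odd := odd_prime_half p p_pr (ltnW p_gt3); rewrite -/m in p_odd.
have n3 : (m %/ 3 = n)%N.
  have : ~~ (3 %| p)%N by rewrite dvdn_prime2 // neq_ltn p_gt3.
  by rewrite /n /m; lia.
case: (leqP k n) => [kn | nk]; last first.
  (* m - k < 2k, so the power sum has no term of degree p - 1. *)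
  rewrite legendre_coef_gt // -mulr_suml.
  case: (leqP k m) => [km | mk]; last by rewrite bin_small // !mulr0 oppr0.
  rewrite sum_cubic_exp // bin_small ?mulr0n ?oppr0 ?mul0r ?mulr0 ?oppr0 //.
  by rewrite -/m; lia.
rewrite -mulr_suml sum_cubic_exp //; last by lia.
rewrite -/m.
have F3 : 3 != 0 :> 'F_p.
  by rewrite -(dvdn_pcharf (pchar_Fp p_pr)) gtnNdvd.
rewrite legendre_symbol_expE // 1?ltnW // -/m.
have F27 : 27 ^+ k != 0 :> 'F_p.
  by rewrite expf_neq0 // (_ : 27 = 3 ^+ 3) ?expf_neq0 //; ring.
apply: (mulfI F27); rewrite trinomial_legendre // /trinomial -/m natrM.
have fermat := finField_expf1 'F_p _ F3; rewrite card_Fp // in fermat.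
have e : 3%:~R ^+ m * (27 ^+ k * 3 ^+ (m - k - 2 * k)) = 1 :> 'F_p.
  rewrite -[RHS]fermat (_ : 27 = 3 ^+ 3); last by ring.
  by rewrite -exprM -!exprD; congr (_ ^+ _); lia.
rewrite -[LHS]mul1r -[X in X * _]e; ring.
Qed.

(** * The two polynomials *)

(** The coefficient of u ^ k = (t - 1) ^ k on the right-hand side. *)
Definition cubic_coef (p k : nat) : int :=
  - (legendre_symbol 3 p *
     \sum_(0 <= x < p) (x%:R ^+ 3 - 3 * x%:R + 2) ^+ ((p - 1) %/ 2 - k) *
       (2 ^+ k * 'C((p - 1) %/ 2, k)%:R)).

Lemma intr_cubic_term (R : comNzRingType) (x i k c : nat) :
  ((x%:R ^+ 3 - 3 * x%:R + 2) ^+ i * (2 ^+ k * c%:R) : int)%:~R =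
  (x%:R ^+ 3 - 3 * x%:R + 2) ^+ i * (2 ^+ k * c%:R) :> R.
Proof.
rewrite rmorphM rmorphXn rmorphM rmorphXn rmorphD rmorphB rmorphXn rmorphM.
by rewrite !rmorph_nat.
Qed.

Lemma coef_cubic_shift (p k : nat) :
  (- ((legendre_symbol 3 p)%:~R *:
      \sum_(0 <= x < p)
        ((x%:R ^+ 3 - 3 * x%:R)%:P + 2 *: 'X) ^+ ((p - 1) %/ 2))
    \Po ('X + 1))`_k = (cubic_coef p k)%:~R :> rat.
Proof.
rewrite rmorphN /= comp_polyZ raddf_sum coefN coefZ coef_sum.
rewrite rmorphN rmorphM rmorph_sum.
congr (- (_ * _)); apply: eq_bigr => x _ /=.
have -> (f g : {poly rat}) i : (f ^+ i) \Po g = (f \Po g) ^+ i.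
  exact: (rmorphXn (comp_poly g)).
rewrite comp_polyD comp_polyC comp_polyZ comp_polyX.
rewrite (_ : _ + _ = (x%:R ^+ 3 - 3 * x%:R + 2)%:P + 2 *: 'X); last first.
  by rewrite [in RHS]polyCD scalerDr alg_polyC addrA addrAC.
rewrite coef_linear_exp -mulr_natr -mulrA.
by rewrite intr_cubic_term.
Qed.

Lemma cubic_coef_congr (p k : nat) : prime p -> (3 < p)%N ->
  (p %| (legendre_coef (p %/ 6) k)%:Z - 2 ^+ k * cubic_coef p k)%Z.
Proof.
move=> p_pr p_gt3; rewrite -intr_Fp_eq0 // rmorphB /= subr_eq0.
rewrite -[X in X == _]/((legendre_coef (p %/ 6) k)%:R) legendre_coef_Fp //.
rewrite rmorphM rmorphN rmorphM rmorph_sum rmorphXn mulrN mulrCA /=.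
apply/eqP; congr (- (_ * _)); rewrite mulr_sumr; apply: eq_bigr => x _.
rewrite intr_cubic_term rmorph_nat.
rewrite (_ : 4 = 2 * 2 :> 'F_p); last by ring.
by rewrite exprMn; ring.
Qed.

Theorem theorem2p3 (p : nat) (p_prime : prime p) (p_gt3 : (3 < p)%N) :
  eqpoly_mod p (legendre_poly (p %/ 6))
    (- ((legendre_symbol 3 p)%:~R *:
        \sum_(0 <= x < p)
          ((x%:R ^+ 3 - 3 * x%:R)%:P + 2 *: 'X) ^+ ((p - 1) %/ 2))).
Proof.
apply/eqpoly_mod_shift/eqpoly_mod_coef => [|k|k].
- exact: prime_gt0.
- by rewrite coef_cubic_shift Rp_int.
rewrite coef_cubic_shift coef_legendre_shift.
have /dvdzP[q qE] := cubic_coef_congr p k p_prime p_gt3.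
have p0 : p%:R != 0 :> rat by rewrite Num.Theory.pnatr_eq0 -lt0n prime_gt0.
apply: (@Rp_frac p q (2 ^+ k)).
  rewrite abszX coprimeXl // coprime2n.
  by case: (even_prime p_prime) p_gt3 => [->|].
apply: (mulIf p0).
have /(congr1 (fun z : int => z%:~R : rat)) := qE.
rewrite (rmorphM _ q) (rmorphB _ (legendre_coef _ _)%:Z) (rmorphM _ (2 ^+ k)).
rewrite rmorphXn rmorph_nat /= -!pmulrn => <-.
rewrite rmorphXn rmorph_nat /=; field.
by rewrite p0 expf_neq0.
Qed.
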